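(* Assume that $p>q>0$. Then the following improper integrals converge and $$I_{p,q}^{\pm}:=\int_{0}^{\infty}e^{\pm ix^{p}}x^{q-1}\,dx=p^{-1}e^{\pm i\frac{\pi}{2}\frac{q}{p}}\,\Gamma\left(\frac{q}{p}\right).$$
   Context: The integral is an improper Riemann integral, $\int_{0}^{\infty}=\lim_{u\to+0,\,v\to\infty}\int_{u}^{v}$. $\Gamma$ is the Gamma function; the double signs $\pm$ are in the same order. *)

(* Defs.v *)
From Stdlib Require Import Reals.
From Coquelicot Require Import Coquelicot.
Open Scope R_scope.

Definition Cexp (z : C) : C :=
  (exp (Re z) * cos (Im z), exp (Re z) * sin (Im z)).

(* Euler's integral, improper at both ends: it defines the Gamma function on
   the positive reals, and [Gamma s] is meaningful only for [0 < s]. *)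
Definition Gamma (s : R) : R :=
  RInt_gen (V := R_CompleteNormedModule)
    (fun t => exp (- t) * Rpower t (s - 1))
    (at_right 0) (Rbar_locally p_infty).

(* [eps] is 1 or -1, the sign in the exponent.  [Rpower] is the real power for
   a positive base, which is all that the integrals over [u, v] with 0 < u
   involve. *)
Definition osc_integrand (eps p q x : R) : C :=
  (Cexp (eps * Ci * Rpower x p) * Rpower x (q - 1))%C.

(* The filters [at_right 0] and [Rbar_locally p_infty] make this the joint limit
   of the Riemann integrals from u to v as u -> +0 and v -> +oo.  C is taken as
   a normed space over R. *)
Definition osc_integral_converges (eps p q : R) : Prop :=
  ex_RInt_gen (V := C_R_CompleteNormedModule) (osc_integrand eps p q)
    (at_right 0) (Rbar_locally p_infty).

Definition osc_integral (eps p q : R) : C :=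
  RInt_gen (V := C_R_CompleteNormedModule) (osc_integrand eps p q)
    (at_right 0) (Rbar_locally p_infty).

(* Main.v *)
(** In the coordinate [t = p ln x], with [s = q / p], the integral becomes
    [1/p] times that of [exp (i e^w + s w)] along the real line (conjugated if
    [eps = -1]), an entire function of [w = t + i th].  On the line
    [th = PI / 2] the integrand is [exp (i PI s / 2) exp (s t - e^t)], whose
    integral is a multiple of [Gamma s] after [x = e^t].  Cauchy's theorem on
    the rectangle [a, b] x [0, PI / 2] compares the two lines; the vertical
    sides contribute at most [PI / 2 e^(s a)] and, by Jordan's inequality,
    [3 e^((s - 1) b)], and both tend to 0 because [0 < s < 1]. *)

Require Import Defs.
From Stdlib Require Import Reals Lra.
From Coquelicot Require Import Coquelicot.
Open Scope R_scope.

(** * Integrals of continuous functions and Cauchy's theorem on a rectangle *)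

Lemma ex_RInt_cont (h : R -> R) (a b : R) :
  (forall x, continuous h x) -> ex_RInt h a b.
Proof.
intros Hh; apply (ex_RInt_continuous (V := R_CompleteNormedModule)); auto.
Qed.

Lemma RInt_derive_cont (f df : R -> R) (a b : R) :
  (forall x, is_derive f x (df x)) -> (forall x, continuous df x) ->
  RInt df a b = f b - f a :> R.
Proof.
intros Hf Hdf.
apply (is_RInt_unique (V := R_CompleteNormedModule)).
apply (is_RInt_derive (V := R_CompleteNormedModule)); auto.
Qed.

Lemma RInt_exp_linear (r a b : R) : r <> 0 ->
  RInt (fun t => exp (r * t)) a b = (exp (r * b) - exp (r * a)) / r :> R.
Proof.
intros Hr.
rewrite (RInt_derive_cont (fun t => exp (r * t) / r)).
- field; assumption.
- intros x; auto_derive; [exact I | field; assumption].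
- intros x; apply (ex_derive_continuous (V := R_NormedModule)); auto_derive.
  exact I.
Qed.

(* Cauchy's theorem on a rectangle, by differentiating the integral of [P th]
   under the integral sign. *)
Lemma RInt_rectangle (P Q D : R -> R -> R) (a b alpha beta : R) :
  (forall th t, is_derive (fun x => P x t) th (D th t)) ->
  (forall th t, is_derive (Q th) t (D th t)) ->
  (forall th t, continuity_2d_pt D th t) ->
  (forall th t, continuous (P th) t) ->
  (forall th t, continuous (fun x => Q x t) th) ->
  RInt (P beta) a b - RInt (P alpha) a b
    = RInt (fun th => Q th b) alpha beta - RInt (fun th => Q th a) alpha beta :> R.
Proof.
intros HP HQ HD HPc HQc.
assert (HDt : forall th t, continuous (D th) t).
{ intros th t.
  assert (H := proj1 (continuity_2d_pt_filterlim _ _ _) (HD th t)).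
  apply (continuous_comp_2 (fun _ => th) (fun x => x) D t); [| | exact H].
  - apply continuous_const.
  - apply continuous_id. }
transitivity (RInt (fun th => minus (Q th b) (Q th a)) alpha beta);
  [symmetry |
   apply (RInt_minus (V := R_CompleteNormedModule));
   apply ex_RInt_cont; intros; apply HQc].
apply (RInt_derive_cont (fun th => RInt (P th) a b)).
- intros th.
  replace (minus (Q th b) (Q th a))
    with (RInt (fun t => Derive (fun x => P x t) th) a b).
  + apply is_derive_RInt_param.
    * exists (mkposreal 1 Rlt_0_1); intros y _ t _.
      exists (D y t); apply HP.
    * intros t _.
      apply continuity_2d_pt_ext with D; [| apply HD].
      intros x y; symmetry; apply is_derive_unique, HP.
    * exists (mkposreal 1 Rlt_0_1); intros y _.
      apply ex_RInt_cont; apply HPc.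
  (* [D th] is also the derivative of [Q th] along [t], so its integral over [[a, b]] is a
     difference of boundary values. *)
  + rewrite (RInt_ext _ (D th)).
    * apply RInt_derive_cont; auto.
    * intros t _; apply is_derive_unique, HP.
- intros th; apply (continuous_minus (V := R_NormedModule)); apply HQc.
Qed.

(** * The substitution [w = p ln x] *)

(** Since [dw = p dx / x], an antiderivative in [x] is the integral of [h] up to [p ln x], divided
    by [p]. Differentiating it gives integrability and value together. *)
Lemma RInt_comp_ln (h : R -> R) (p u v : R) :
  (forall x, continuous h x) -> 0 < p -> 0 < u -> 0 < v ->
  is_RInt (fun x => h (p * ln x) / x) u v
    (RInt h (p * ln u) (p * ln v) / p).
Proof.
intros Hh Hp Hu Hv.
assert (Hpos : forall x, Rmin u v <= x -> 0 < x).
{ intros x Hx; apply Rlt_le_trans with (2 := Hx), Rmin_glb_lt; assumption. }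
(* The subtracted integral is over a point, hence 0; it gives the value the shape [F v - F u]. *)
replace (RInt h (p * ln u) (p * ln v) / p) with
  (minus (RInt h (p * ln u) (p * ln v) / p)
         (RInt h (p * ln u) (p * ln u) / p)).
2: { rewrite RInt_point; unfold minus, plus, opp, zero; simpl.
     unfold Rdiv; ring. }
apply (is_RInt_derive (V := R_CompleteNormedModule)
         (fun x => RInt h (p * ln u) (p * ln x) / p)).
- intros x [Hx _]; specialize (Hpos x Hx).
  replace (h (p * ln x) / x) with (/ p * ((p * / x) * h (p * ln x)))
    by (field; split; apply Rgt_not_eq; assumption).
  apply is_derive_ext with (fun x => / p * RInt h (p * ln u) (p * ln x)).
  { intros y; unfold Rdiv; apply Rmult_comm. }
  apply is_derive_scal.
  apply (is_derive_comp (V := R_NormedModule) (fun y => RInt h (p * ln u) y)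
           (fun x => p * ln x)).
  + apply (is_derive_RInt h _ (p * ln u)).
    * exists (mkposreal 1 Rlt_0_1); intros y _.
      apply (RInt_correct (V := R_CompleteNormedModule)), ex_RInt_cont, Hh.
    * apply Hh.
  + auto_derive; [assumption | ring].
- intros x [Hx _]; specialize (Hpos x Hx).
  apply (continuous_mult (K := R_AbsRing) (fun x => h (p * ln x)) (fun x => / x)).
  + apply (continuous_comp (fun x => p * ln x) h); [| apply Hh].
    apply (ex_derive_continuous (V := R_NormedModule)); auto_derive.
    assumption.
  + apply (ex_derive_continuous (V := R_NormedModule)); auto_derive.
    apply Rgt_not_eq; assumption.
Qed.

Notation whole_line := (filter_prod (Rbar_locally m_infty) (Rbar_locally p_infty)).

Lemma filterlim_scaled_ln (p : R) : 0 < p ->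
  filterlim (fun ab => (p * ln (fst ab), p * ln (snd ab)))
    (filter_prod (at_right 0) (Rbar_locally p_infty)) whole_line.
Proof.
intros Hp.
apply filterlim_pair.
- apply (filterlim_comp _ _ _ fst (fun x => p * ln x) _ (at_right 0));
    [apply filterlim_fst |].
  apply (filterlim_comp _ _ _ ln (Rmult p) _ (Rbar_locally m_infty));
    [apply is_lim_ln_0 |].
  assert (H := filterlim_Rbar_mult_l p m_infty).
  replace (Rbar_mult p m_infty) with m_infty in H; [exact H |].
  symmetry; apply is_Rbar_mult_unique, is_Rbar_mult_sym.
  apply is_Rbar_mult_m_infty_pos; assumption.
- apply (filterlim_comp _ _ _ snd (fun x => p * ln x) _ (Rbar_locally p_infty));
    [apply filterlim_snd |].
  apply (filterlim_comp _ _ _ ln (Rmult p) _ (Rbar_locally p_infty));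
    [apply is_lim_ln_p |].
  assert (H := filterlim_Rbar_mult_l p p_infty).
  replace (Rbar_mult p p_infty) with p_infty in H; [exact H |].
  symmetry; apply is_Rbar_mult_unique, is_Rbar_mult_sym.
  apply is_Rbar_mult_p_infty_pos; assumption.
Qed.

Lemma filterlim_RInt_comp_ln (h : R -> R) (p l : R) : 0 < p ->
  filterlim (fun ab => RInt h (fst ab) (snd ab)) whole_line (locally l) ->
  filterlim (fun ab => RInt h (p * ln (fst ab)) (p * ln (snd ab)) / p)
    (filter_prod (at_right 0) (Rbar_locally p_infty)) (locally (l / p)).
Proof.
intros Hp Hl.
apply (filterlim_comp _ _ _
  (fun ab => RInt h (p * ln (fst ab)) (p * ln (snd ab))) (fun y => y / p)
  _ (locally l)).
- apply (filterlim_comp _ _ _ _ _ _ _ _ (filterlim_scaled_ln p Hp) Hl).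
- apply filterlim_ext with (fun y => scal (/ p) y).
  { intros y; apply Rmult_comm. }
  replace (l / p) with (scal (/ p) l) by apply Rmult_comm.
  apply (filterlim_scal_r (K := R_AbsRing) (V := R_NormedModule)).
Qed.

(** * Improper integrals as limits of proper ones *)

Lemma at_right_p_infty_pos :
  filter_prod (at_right 0) (Rbar_locally p_infty)
    (fun ab : R * R => 0 < fst ab /\ 0 < snd ab).
Proof.
apply Filter_prod with (fun x => 0 < x) (fun x => 0 < x).
- exists (mkposreal 1 Rlt_0_1); intros; assumption.
- exists 0; auto.
- simpl; auto.
Qed.

(** [is_RInt_gen] is a limit of a relation between endpoints and values; an explicit value [G] on
    eventually all intervals turns it into the limit of a function. *)
Lemma is_RInt_gen_of_filterlim {V : NormedModule R_AbsRing} (f : R -> V)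
    (Fa Fb : (R -> Prop) -> Prop) {FFa : Filter Fa} {FFb : Filter Fb}
    (G : R * R -> V) (l : V) :
  filter_prod Fa Fb (fun ab => is_RInt f (fst ab) (snd ab) (G ab)) ->
  filterlim G (filter_prod Fa Fb) (locally l) ->
  is_RInt_gen f Fa Fb l.
Proof.
intros Hf HG P HP; unfold filtermapi.
apply (filter_imp (fun ab => is_RInt f (fst ab) (snd ab) (G ab) /\ P (G ab))).
- intros ab H; exists (G ab); exact H.
- apply filter_and; [exact Hf | exact (HG P HP)].
Qed.

(** For a nonnegative integrand the integral grows with the interval, so the bounded family
    converges to its supremum. *)
Lemma ex_filterlim_RInt_nonneg (h : R -> R) (M : R) :
  (forall x, continuous h x) -> (forall x, 0 <= h x) ->
  (forall a b, a <= 0 -> 0 <= b -> RInt h a b <= M) ->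
  exists l, filterlim (fun ab => RInt h (fst ab) (snd ab)) whole_line (locally l).
Proof.
intros Hh Hpos HM.
destruct (completeness
  (fun y => exists a b, a <= 0 /\ 0 <= b /\ y = RInt h a b)) as [l [Hub Hlub]].
- exists M; intros y (a & b & Ha & Hb & ->); auto.
- exists (RInt h 0 0), 0, 0; repeat split; apply Rle_refl.
- exists l.
  apply filterlim_locally; intros e.
  assert (He := cond_pos e).
  (* Otherwise [l - e] would be an upper bound smaller than the least one. *)
  assert (Hex : exists a0 b0, a0 <= 0 /\ 0 <= b0 /\ l - e < RInt h a0 b0).
  { apply Classical_Prop.NNPP; intros Hn.
    assert (l <= l - e); [| lra].
    apply Hlub; intros y (a & b & Ha & Hb & ->).
    apply Rnot_lt_le; intros Hlt; apply Hn; exists a, b; auto. }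
  destruct Hex as (a0 & b0 & Ha0 & Hb0 & Hlt).
  apply Filter_prod with (fun x => x < a0) (fun x => b0 < x).
  + exists a0; auto.
  + exists b0; auto.
  + intros a b Ha Hb; simpl.
    (* The integral over [[a, b]] is at most [l], and at least the one over [[a0, b0]] because the
       two outer pieces are nonnegative. *)
    assert (H1 := Hub (RInt h a b)
      (ex_intro _ a (ex_intro _ b (conj (Rlt_le _ _ (Rlt_le_trans _ _ _ Ha Ha0))
        (conj (Rle_trans _ _ _ Hb0 (Rlt_le _ _ Hb)) eq_refl))))).
    assert (H2 : RInt h a b = RInt h a a0 + RInt h a0 b0 + RInt h b0 b).
    { rewrite <- (RInt_Chasles h a b0 b), <- (RInt_Chasles h a a0 b0)
        by (apply ex_RInt_cont, Hh).
      reflexivity. }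
    assert (H3 : 0 <= RInt h a a0).
    { apply RInt_ge_0; [lra | apply ex_RInt_cont, Hh | auto]. }
    assert (H4 : 0 <= RInt h b0 b).
    { apply RInt_ge_0; [lra | apply ex_RInt_cont, Hh | auto]. }
    apply Rabs_def1; unfold minus, plus, opp; simpl; lra.
Qed.

(** * The Gamma integral in the logarithmic coordinate *)

Lemma exp_le_compat (x y : R) : x <= y -> exp x <= exp y.
Proof.
intros [H | ->]; [apply Rlt_le, exp_increasing, H | apply Rle_refl].
Qed.

(** Squaring [1 + t / 2 <= exp (t / 2)] suffices, as [(1 + t / 2)^2 - 2 t = (1 - t / 2)^2]. For
    [s < 1] and [t >= 0] this yields [s t - exp t <= - t], an integrable majorant. *)
Lemma exp_ge_2x (t : R) : 0 <= t -> 2 * t <= exp t.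
Proof.
intros Ht.
replace (exp t) with (exp (t / 2) * exp (t / 2))
  by (rewrite <- exp_plus; f_equal; field).
assert (1 + t / 2 <= exp (t / 2)) by apply exp_ineq1_le.
assert (0 <= (1 - t / 2) * (1 - t / 2)) by apply Rle_0_sqr.
assert ((1 + t / 2) * (1 + t / 2) <= exp (t / 2) * exp (t / 2))
  by (apply Rmult_le_compat; lra).
lra.
Qed.

Lemma gamma_log_continuous (s x : R) :
  continuous (fun t => exp (s * t - exp t)) x.
Proof.
apply (ex_derive_continuous (V := R_NormedModule)); auto_derive; exact I.
Qed.

Lemma exp_linear_continuous (r x : R) : continuous (fun t => exp (r * t)) x.
Proof.
apply (ex_derive_continuous (V := R_NormedModule)); auto_derive; exact I.
Qed.

(** Convergence comes first: the majorant [exp (s t)] contributes at most [1 / s] on the negative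
    axis, and [exp (- t)] at most 1 on the positive one. The substitution [x = exp t] then
    identifies the limit. *)
Lemma Gamma_log (s : R) : 0 < s < 1 ->
  filterlim (fun ab => RInt (fun t => exp (s * t - exp t)) (fst ab) (snd ab))
    whole_line (locally (Gamma s)).
Proof.
intros [Hs0 Hs1].
destruct (ex_filterlim_RInt_nonneg (fun t => exp (s * t - exp t)) (/ s + 1))
  as [l Hl].
- apply gamma_log_continuous.
- intros x; apply Rlt_le, exp_pos.
- intros a b Ha Hb.
  rewrite <- (RInt_Chasles _ a 0 b)
    by (apply ex_RInt_cont; intros; apply gamma_log_continuous).
  apply Rplus_le_compat.
  + apply Rle_trans with (RInt (fun t => exp (s * t)) a 0).
    * apply RInt_le; [assumption | | |].
      -- apply ex_RInt_cont; intros; apply gamma_log_continuous.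
      -- apply ex_RInt_cont; intros; apply exp_linear_continuous.
      -- intros t _; apply exp_le_compat.
         assert (H := exp_pos t); lra.
    * rewrite RInt_exp_linear by lra.
      rewrite Rmult_0_r, exp_0.
      assert (H := exp_pos (s * a)).
      assert (H' := Rinv_0_lt_compat _ Hs0).
      unfold Rdiv; nra.
  + apply Rle_trans with (RInt (fun t => exp (- 1 * t)) 0 b).
    * apply RInt_le; [assumption | | |].
      -- apply ex_RInt_cont; intros; apply gamma_log_continuous.
      -- apply ex_RInt_cont; intros; apply exp_linear_continuous.
      -- intros t Ht; apply exp_le_compat.
         assert (H := exp_ge_2x t); nra.
    * rewrite RInt_exp_linear by lra.
      rewrite Rmult_0_r, exp_0.
      assert (H := exp_pos (- 1 * b)).
      lra.
- replace (Gamma s) with l; [exact Hl | symmetry].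
  apply is_RInt_gen_unique.
  (* This is the form that the logarithmic substitution produces for [p = 1]. *)
  replace l with (l / 1) by field.
  refine (is_RInt_gen_of_filterlim _ _ _ _ _ _
    (filterlim_RInt_comp_ln _ 1 l Rlt_0_1 Hl)).
  generalize at_right_p_infty_pos; apply filter_imp; intros [u v]; simpl.
  intros [Hu Hv].
  eapply is_RInt_ext; [| apply RInt_comp_ln; auto using gamma_log_continuous,
    Rlt_0_1].
  intros x [Hx _]; simpl.
  assert (0 < x) by (apply Rlt_trans with (2 := Hx), Rmin_glb_lt; assumption).
  unfold Rpower; rewrite Rmult_1_l, exp_ln by assumption.
  replace (s * ln x - x) with (- x + (s - 1) * ln x + ln x) by ring.
  rewrite !exp_plus, exp_ln by assumption.
  field; lra.
Qed.

(** * The rotated integrand and its Cauchy-Riemann equations *)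

(* Real part of [exp (i c) * exp (i exp w + s w)] at [w = t + i th]. *)
Definition ray (s c th t : R) : R :=
  exp (s * t - exp t * sin th) * cos (exp t * cos th + s * th + c).

Lemma cos_add_PI2 (x : R) : cos (x + PI / 2) = - sin x.
Proof. rewrite cos_plus, cos_PI2, sin_PI2; ring. Qed.

Lemma ray_derive_angle (s c th t : R) :
  is_derive (fun x => ray s c x t) th
    (- exp (s * t - exp t * sin th) *
      (exp t * cos th * cos (exp t * cos th + s * th + c)
       + (s - exp t * sin th) * sin (exp t * cos th + s * th + c))).
Proof. unfold ray; auto_derive; [exact I | unfold Rminus; ring]. Qed.

(* Cauchy-Riemann: the angular derivative of a holomorphic function is [i]
   times its radial derivative. *)
Lemma ray_derive_radial (s c th t : R) :
  is_derive (ray s (c + PI / 2) th) t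
    (- exp (s * t - exp t * sin th) *
      (exp t * cos th * cos (exp t * cos th + s * th + c)
       + (s - exp t * sin th) * sin (exp t * cos th + s * th + c))).
Proof.
apply is_derive_ext with
  (fun t => - (exp (s * t - exp t * sin th) * sin (exp t * cos th + s * th + c))).
{ intros x; unfold ray; rewrite <- Rplus_assoc, cos_add_PI2; simpl; ring. }
auto_derive; [exact I | unfold Rminus; ring].
Qed.

Lemma continuity_2d_pt_comp (f : R -> R) (g : R -> R -> R) (x y : R) :
  (forall z, ex_derive f z) -> continuity_2d_pt g x y ->
  continuity_2d_pt (fun u v => f (g u v)) x y.
Proof.
intros Hf; apply continuity_1d_2d_pt_comp.
apply continuity_pt_filterlim, (ex_derive_continuous (V := R_NormedModule)), Hf.
Qed.

Lemma ray_derive_continuity (s c th t : R) :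
  continuity_2d_pt (fun th t =>
    - exp (s * t - exp t * sin th) *
      (exp t * cos th * cos (exp t * cos th + s * th + c)
       + (s - exp t * sin th) * sin (exp t * cos th + s * th + c))) th t.
Proof.
repeat first
  [ apply continuity_2d_pt_mult | apply continuity_2d_pt_plus
  | apply continuity_2d_pt_minus | apply continuity_2d_pt_opp
  | apply continuity_2d_pt_const | apply continuity_2d_pt_id1
  | apply continuity_2d_pt_id2
  | apply (continuity_2d_pt_comp exp); [intros; auto_derive; exact I |]
  | apply (continuity_2d_pt_comp sin); [intros; auto_derive; exact I |]
  | apply (continuity_2d_pt_comp cos); [intros; auto_derive; exact I |] ].
Qed.

Lemma ray_continuous_radial (s c th t : R) : continuous (ray s c th) t.
Proof.
apply (ex_derive_continuous (V := R_NormedModule)); unfold ray; auto_derive.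
exact I.
Qed.

Lemma ray_continuous_angle (s c th t : R) : continuous (fun x => ray s c x t) th.
Proof.
apply (ex_derive_continuous (V := R_NormedModule)); unfold ray; auto_derive.
exact I.
Qed.

(** Adding [PI / 2] to the phase [c] multiplies the holomorphic function by [i], which is the factor
    in [dw = i dth] on the vertical sides. Keeping [c] free lets one real identity serve both the
    real and the imaginary part. *)
Lemma ray_rotation (s c a b : R) :
  RInt (ray s c 0) a b = RInt (ray s c (PI / 2)) a b
    - RInt (fun th => ray s (c + PI / 2) th b) 0 (PI / 2)
    + RInt (fun th => ray s (c + PI / 2) th a) 0 (PI / 2) :> R.
Proof.
assert (H := RInt_rectangle _ _ _ a b 0 (PI / 2)
  (ray_derive_angle s c) (ray_derive_radial s c) (ray_derive_continuity s c)
  (ray_continuous_radial s c) (ray_continuous_angle s (c + PI / 2))).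
lra.
Qed.

(** * Decay of the vertical sides *)

(** A weak form of Jordan's inequality: [sin x >= x - x^3 / 6 = x / 3 + x (4 - x^2) / 6], and
    [x <= PI / 2 <= 2]. *)
Lemma sin_ge_third (x : R) : 0 <= x <= PI / 2 -> x / 3 <= sin x.
Proof.
intros Hx.
assert (HPI := PI_4).
destruct (pre_sin_bound x 0) as [H _]; [lra | lra |].
unfold sin_approx, sin_term in H; simpl in H.
assert (x * x <= 4) by nra.
assert (0 <= x * (4 - x * x)) by (apply Rmult_le_pos; lra).
lra.
Qed.

Lemma ray_abs_le (s c th t : R) : 0 <= th <= PI / 2 ->
  Rabs (ray s c th t) <= exp (s * t) * exp (- (exp t / 3) * th).
Proof.
intros Hth; unfold ray.
rewrite Rabs_mult, <- exp_plus.
rewrite (Rabs_pos_eq (exp _)) by apply Rlt_le, exp_pos.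
rewrite <- (Rmult_1_r (exp (_ + _))).
apply Rmult_le_compat; [apply Rlt_le, exp_pos | apply Rabs_pos | |].
- apply exp_le_compat.
  assert (H := sin_ge_third th Hth); assert (H' := exp_pos t); nra.
- apply Rabs_le, COS_bound.
Qed.

(** The integral over [th] of [exp (- (exp t / 3) th)] is at most [3 / exp t], which beats the
    factor [exp (s t)] at plus infinity when [s < 1]. *)
Lemma arc_abs_le_large (s c t : R) :
  Rabs (RInt (fun th => ray s c th t) 0 (PI / 2)) <= 3 * exp ((s - 1) * t).
Proof.
assert (HPI := PI_RGT_0); assert (Ht := exp_pos t).
apply Rle_trans with
  (RInt (fun th => exp (s * t) * exp (- (exp t / 3) * th)) 0 (PI / 2)).
- apply Rle_trans with (RInt (fun th => Rabs (ray s c th t)) 0 (PI / 2)).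
  + apply abs_RInt_le; [lra | apply ex_RInt_cont].
    intros; apply ray_continuous_angle.
  + apply RInt_le; [lra | | |].
    * apply ex_RInt_cont; intros x.
      apply (continuous_comp (fun x => ray s c x t) Rabs);
        [apply ray_continuous_angle | apply continuous_Rabs].
    * apply ex_RInt_cont; intros x.
      apply (continuous_scal_r (K := R_AbsRing) (V := R_NormedModule)).
      apply exp_linear_continuous.
    * intros th Hth; apply ray_abs_le; lra.
- rewrite (RInt_scal (V := R_CompleteNormedModule))
    by (apply ex_RInt_cont; intros; apply exp_linear_continuous).
  rewrite RInt_exp_linear by lra.
  unfold scal; simpl; unfold mult; simpl.
  rewrite Rmult_0_r, exp_0.
  replace ((s - 1) * t) with (s * t + - t) by ring.
  rewrite exp_plus, exp_Ropp.
  set (y := exp (- (exp t / 3) * (PI / 2))).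
  assert (Hy : 0 < y) by apply exp_pos.
  replace (exp (s * t) * ((y - 1) / - (exp t / 3)))
    with (3 * (exp (s * t) * / exp t) - 3 * (exp (s * t) * / exp t * y))
    by (field; lra).
  assert (0 < exp (s * t) * / exp t * y); [| lra].
  repeat apply Rmult_lt_0_compat; try apply exp_pos; try assumption.
  apply Rinv_0_lt_compat, exp_pos.
Qed.

(** Here the exponential in [th] is just bounded by 1, leaving the length of the side times
    [exp (s t)]; this decays at minus infinity when [s > 0]. *)
Lemma arc_abs_le_small (s c t : R) :
  Rabs (RInt (fun th => ray s c th t) 0 (PI / 2)) <= PI / 2 * exp (s * t).
Proof.
assert (HPI := PI_RGT_0).
rewrite <- (Rminus_0_r (PI / 2)) at 2.
apply abs_RInt_le_const; [lra | |].
- apply ex_RInt_cont; intros; apply ray_continuous_angle.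
- intros th Hth; apply Rle_trans with (1 := ray_abs_le s c th t Hth).
  rewrite <- (Rmult_1_r (exp (s * t))) at 2.
  apply Rmult_le_compat_l; [apply Rlt_le, exp_pos |].
  rewrite <- exp_0; apply exp_le_compat.
  assert (H := exp_pos t); nra.
Qed.

Lemma filterlim_abs_le_0 {T : Type} (F : (T -> Prop) -> Prop) {FF : Filter F}
    (f g : T -> R) :
  (forall x, Rabs (f x) <= g x) ->
  filterlim g F (locally 0) -> filterlim f F (locally 0).
Proof.
intros Hfg Hg.
apply filterlim_locally; intros e.
generalize (proj1 (filterlim_locally g 0) Hg e).
apply filter_imp; intros x Hx.
assert (H := Rabs_def2 _ _ Hx); specialize (Hfg x).
unfold minus, plus, opp in H; simpl in H.
unfold ball; simpl; unfold AbsRing_ball, abs, minus, plus, opp; simpl.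
rewrite Ropp_0, Rplus_0_r; lra.
Qed.

(** The hypothesis on [Rbar_mult] covers both uses: [r < 0] at plus infinity and [r > 0] at minus
    infinity. *)
Lemma filterlim_exp_linear (k r : R) (z : Rbar) :
  Rbar_mult r z = m_infty ->
  filterlim (fun t => k * exp (r * t)) (Rbar_locally z) (locally 0).
Proof.
intros Hz.
rewrite <- (Rmult_0_r k).
apply (filterlim_comp _ _ _ (fun t => exp (r * t)) (Rmult k) _ (locally 0));
  [| apply (filterlim_scal_r (K := R_AbsRing) (V := R_NormedModule))].
apply (filterlim_comp _ _ _ (Rmult r) exp _ (Rbar_locally m_infty));
  [| apply is_lim_exp_m].
rewrite <- Hz; apply filterlim_Rbar_mult_l.
Qed.

Lemma arc_lim_p_infty (s c : R) : s < 1 ->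
  filterlim (fun t => RInt (fun th => ray s c th t) 0 (PI / 2))
    (Rbar_locally p_infty) (locally 0).
Proof.
intros Hs.
apply (filterlim_abs_le_0 _ _ _ (arc_abs_le_large s c)).
apply filterlim_exp_linear.
apply is_Rbar_mult_unique, is_Rbar_mult_sym, is_Rbar_mult_p_infty_neg.
simpl; lra.
Qed.

Lemma arc_lim_m_infty (s c : R) : 0 < s ->
  filterlim (fun t => RInt (fun th => ray s c th t) 0 (PI / 2))
    (Rbar_locally m_infty) (locally 0).
Proof.
intros Hs.
apply (filterlim_abs_le_0 _ _ _ (arc_abs_le_small s c)).
apply filterlim_exp_linear.
apply is_Rbar_mult_unique, is_Rbar_mult_sym, is_Rbar_mult_m_infty_pos.
exact Hs.
Qed.

(** * The limit along the real line *)

(** At [th = PI / 2], [exp w = i exp t], so the phase no longer depends on [t]. *)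
Lemma ray_vertical (s c t : R) :
  ray s c (PI / 2) t = cos (s * (PI / 2) + c) * exp (s * t - exp t).
Proof.
unfold ray; rewrite sin_PI2, cos_PI2, Rmult_0_r, Rplus_0_l, Rmult_1_r.
apply Rmult_comm.
Qed.

Lemma ray_horizontal_lim (s c : R) : 0 < s < 1 ->
  filterlim (fun ab => RInt (ray s c 0) (fst ab) (snd ab))
    whole_line (locally (cos (s * (PI / 2) + c) * Gamma s)).
Proof.
intros Hs.
set (k := cos (s * (PI / 2) + c)).
set (arc t := RInt (fun th => ray s (c + PI / 2) th t) 0 (PI / 2)).
(* By [ray_rotation] the integral splits into a multiple of the Gamma integral and two vertical
   sides, whose limits are taken separately. *)
apply filterlim_ext with (fun ab =>
  plus (k * RInt (fun t => exp (s * t - exp t)) (fst ab) (snd ab))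
    (plus (opp (arc (snd ab))) (arc (fst ab)))).
{ intros [a b]; simpl; rewrite ray_rotation.
  rewrite (RInt_ext (ray s c (PI / 2)) (fun t => scal k (exp (s * t - exp t))))
    by (intros; apply ray_vertical).
  rewrite (RInt_scal (V := R_CompleteNormedModule))
    by (apply ex_RInt_cont; intros; apply gamma_log_continuous).
  unfold arc, plus, opp, scal; simpl; unfold mult; simpl; ring. }
replace (k * Gamma s) with (plus (k * Gamma s) (plus (opp 0) 0))
  by (unfold plus, opp; simpl; ring).
eapply filterlim_comp_2; [| | apply (filterlim_plus (V := R_NormedModule))].
- apply (filterlim_comp _ _ _ _ (Rmult k) _ _ _ (Gamma_log s Hs)).
  apply (filterlim_scal_r (K := R_AbsRing) (V := R_NormedModule)).
- eapply filterlim_comp_2; [| | apply (filterlim_plus (V := R_NormedModule))].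
  + apply (filterlim_comp _ _ _ (fun ab => arc (snd ab)) opp _ (locally 0));
      [| apply (filterlim_opp (V := R_NormedModule))].
    apply (filterlim_comp _ _ _ _ _ _ _ _ filterlim_snd).
    apply arc_lim_p_infty, Hs.
  + apply (filterlim_comp _ _ _ _ _ _ _ _ filterlim_fst).
    apply arc_lim_m_infty, Hs.
Qed.

(** * Return to the oscillatory integral *)

(** With [w = p ln x] and [s = q / p], [exp w = x^p] and [exp (s w) = x^q]. The phase [- PI / 2]
    multiplies by [- i] and so extracts the imaginary part; [eps = -1] conjugates, changing the sign
    of that component only. *)
Lemma osc_integrand_ray (eps p q x : R) :
  eps = 1 \/ eps = -1 -> 0 < p -> 0 < x ->
  osc_integrand eps p q x =
    (ray (q / p) 0 0 (p * ln x) / x,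
     eps * (ray (q / p) (- (PI / 2)) 0 (p * ln x) / x)).
Proof.
intros Heps Hp Hx.
assert (Hexp : exp (q / p * (p * ln x)) / x = Rpower x (q - 1)).
{ unfold Rpower; replace (q / p * (p * ln x)) with ((q - 1) * ln x + ln x)
    by (field; lra).
  rewrite exp_plus, exp_ln by assumption; field; lra. }
unfold ray; rewrite sin_0, cos_0, !Rmult_0_r, !Rmult_1_r, Rminus_0_r, !Rplus_0_r.
fold (Rpower x p).
rewrite cos_plus, cos_neg, sin_neg, cos_PI2, sin_PI2.
unfold osc_integrand, Cexp; rewrite <- Hexp.
unfold Cmult, Ci, RtoC, Re, Im; simpl.
replace ((eps * 0 - 0 * 1) * Rpower x p - (eps * 1 + 0 * 0) * 0) with 0 by ring.
replace ((eps * 0 - 0 * 1) * 0 + (eps * 1 + 0 * 0) * Rpower x p)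
  with (eps * Rpower x p) by ring.
rewrite exp_0.
destruct Heps as [-> | ->].
- rewrite !Rmult_1_l; f_equal; field; lra.
- replace (-1 * Rpower x p) with (- Rpower x p) by ring.
  rewrite cos_neg, sin_neg; f_equal; field; lra.
Qed.

Lemma osc_integral_is (eps p q : R) :
  0 < q -> q < p -> eps = 1 \/ eps = -1 ->
  is_RInt_gen (V := C_R_CompleteNormedModule) (osc_integrand eps p q)
    (at_right 0) (Rbar_locally p_infty)
    (/ p * Cexp (eps * Ci * (PI / 2) * (q / p)) * Gamma (q / p)%R)%C.
Proof.
intros Hq Hqp Heps.
assert (Hp : 0 < p) by lra.
assert (Hs : 0 < q / p < 1).
{ split; [apply Rdiv_lt_0_compat; assumption |].
  apply Rmult_lt_reg_r with p; [assumption |].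
  replace (q / p * p) with q by (field; lra); lra. }
assert (H1 := filterlim_RInt_comp_ln _ p _ Hp (ray_horizontal_lim (q / p) 0 Hs)).
assert (H2 := filterlim_RInt_comp_ln _ p _ Hp
  (ray_horizontal_lim (q / p) (- (PI / 2)) Hs)).
set (s := q / p) in *.
(* The target is split into components, using [cos (y - PI / 2) = sin y] for the imaginary one. *)
replace (/ p * Cexp (eps * Ci * (PI / 2) * (q / p)) * Gamma s)%C
  with (cos (s * (PI / 2) + 0) * Gamma s / p,
        eps * (cos (s * (PI / 2) + - (PI / 2)) * Gamma s / p)).
2: {
  rewrite <- !RtoC_div, <- RtoC_inv by lra; fold s.
  replace (eps * Ci * (PI / 2)%R * s)%C with ((0, eps * (s * (PI / 2))) : C)
    by (unfold Cmult, Ci, RtoC; simpl; f_equal; field).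
  rewrite Rplus_0_r, cos_plus, cos_neg, sin_neg, cos_PI2, sin_PI2.
  unfold Cexp, Re, Im, Cmult, RtoC; simpl; rewrite exp_0.
  destruct Heps as [-> | ->].
  - rewrite !Rmult_1_l; f_equal; field; lra.
  - replace (-1 * (s * (PI / 2))) with (- (s * (PI / 2))) by ring.
    rewrite cos_neg, sin_neg; f_equal; field; lra. }
refine (is_RInt_gen_of_filterlim (V := C_R_NormedModule) _ _ _
  (fun ab : R * R =>
    ((RInt (ray s 0 0) (p * ln (fst ab)) (p * ln (snd ab)) / p,
      eps * (RInt (ray s (- (PI / 2)) 0) (p * ln (fst ab)) (p * ln (snd ab)) / p))
     : C)) _ _ _).
- generalize at_right_p_infty_pos; apply filter_imp; intros [u v]; simpl.
  intros [Hu Hv].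
  apply (is_RInt_ext (V := C_R_NormedModule)) with (fun x =>
    (ray (q / p) 0 0 (p * ln x) / x,
     eps * (ray (q / p) (- (PI / 2)) 0 (p * ln x) / x))).
  { intros x [Hx _]; symmetry; apply osc_integrand_ray; [assumption .. |].
    apply Rlt_trans with (2 := Hx), Rmin_glb_lt; assumption. }
  apply (is_RInt_fct_extend_pair (U := R_NormedModule) (V := R_NormedModule)).
  + apply RInt_comp_ln; auto using ray_continuous_radial.
  + apply (is_RInt_scal (V := R_NormedModule)).
    apply RInt_comp_ln; auto using ray_continuous_radial.
- assert (H3 := filterlim_comp _ _ _ _ _ _ _ _ H2
    (filterlim_scal_r (K := R_AbsRing) (V := R_NormedModule) eps _)).
  (* A ball in [C] is here a product of balls, so the two real limits give the complex one. *)
  apply filterlim_locally; intros e.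
  generalize (filter_and (F := filter_prod _ _) _ _
    (proj1 (filterlim_locally _ _) H1 e) (proj1 (filterlim_locally _ _) H3 e)).
  apply filter_imp; intros ab H; exact H.
Qed.

Theorem lemma5p1 (p q : R) (hq : 0 < q) (hqp : q < p)
    (eps : R) (heps : eps = 1 \/ eps = -1) :
  osc_integral_converges eps p q /\
  osc_integral eps p q
    = (/ p * Cexp (eps * Ci * (PI / 2) * (q / p)) * Gamma (q / p)%R)%C.
Proof.
assert (H := osc_integral_is eps p q hq hqp heps).
split.
- eexists; exact H.
- apply (is_RInt_gen_unique (V := C_R_CompleteNormedModule)); exact H.
Qed.
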